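(* Let $r,p,s,n$ be positive integers such that $p\mid r$, $s\mid r$ and $ps\mid rn$. Then, as formal power series in $t,q$, $$\Bigg\{\sum_{k\geq0}t^k\Big[\frac{r}{s}k+1\Big]_q^n\Bigg\}_{q^p}=\frac{\sum_{g\in G(r,p,s,n)}t^{\mathrm{des}(g)}q^{\mathrm{fmaj}(g)}}{(1-t)(1-t^sq^r)(1-t^sq^{2r})\cdots(1-t^sq^{(n-1)r})(1-tq^{nr/s})}.$$
   Context: Notation. For a positive integer $m$, $R_m(i)\in\{0,\ldots,m-1\}$ denotes the residue of $i\in\mathbb Z$ modulo $m$. $[m]_x=1+x+\cdots+x^{m-1}$. For a power series $F$, $\{F\}_{q^p}$ is obtained from $F$ by discarding all terms whose degree in $q$ is not divisible by $p$. Groups. $G(r,n)$ is the group of pairs $(c_1,\ldots,c_n;\sigma)$ with $c_i\in\{0,\ldots,r-1\}$ (the colors) and $\sigma\in S_n$, with product $(d_1,\ldots,d_n;\tau)(c_1,\ldots,c_n;\sigma)=(R_r(c_1+d_{\sigma(1)}),\ldots,R_r(c_n+d_{\sigma(n)});\tau\sigma)$. For $p\mid r$, $G(r,p,n)$ is the subgroup of elements with $c_1+\cdots+c_n\equiv 0 \bmod p$. For $s\mid r$ with $ps\mid rn$, $C_s\subseteq G(r,p,n)$ is the cyclic subgroup of order $s$ generated by $(r/s,\ldots,r/s;\mathrm{id})$, and $G(r,p,s,n)=G(r,p,n)/C_s$. Statistics. For $g\in G(r,p,s,n)$ represented by $(c_1,\ldots,c_n;\sigma)$ let $\mathrm{HDes}(g)=\{i\in\{1,\ldots,n-1\}: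 c_i=c_{i+1},\ \sigma(i)>\sigma(i+1)\}$, $h_i(g)=\#\{j\ge i: j\in\mathrm{HDes}(g)\}$, $k_n(g)=R_{r/s}(c_n)$, $k_i(g)=k_{i+1}(g)+R_r(c_i-c_{i+1})$ for $1\le i\le n-1$, $\lambda_i(g)=r\,h_i(g)+k_i(g)$. Then $\mathrm{fmaj}(g)=\sum_{i=1}^n\lambda_i(g)$ and $\mathrm{des}(g)=\left\lfloor\frac{s\lambda_1(g)+r-s}{r}\right\rfloor$. These do not depend on the representative chosen. *)

(* Defs.v *)
From HB Require Import structures.
From mathcomp Require Import all_boot all_order all_algebra all_fingroup.
From mathcomp Require Import boolp.

Set Implicit Arguments.
Unset Strict Implicit.
Unset Printing Implicit Defensive.

Import GRing.Theory.

(* Formal power series in one variable.  The ring A[[t,q]] is represented as  *)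
(* the iterated ring A[[q]][[t]], i.e. [fps (fps A)]: the coefficient of      *)
(* t^k q^i in F is [F k i].                                                   *)

Section FormalPowerSeries.
Local Open Scope ring_scope.

Record fps (A : Type) := Fps { fcoef :> nat -> A }.

Lemma fpsP (A : Type) (f g : fps A) : f =1 g <-> f = g.
Proof.
split=> [|-> //]; case: f => f; case: g => g /= fg.
by congr Fps; apply/funext.
Qed.

HB.instance Definition _ (A : Type) := gen_eqMixin (fps A).
HB.instance Definition _ (A : Type) := gen_choiceMixin (fps A).

Section Ring.
Variable A : comNzRingType.
Implicit Types f g h : fps A.

Definition fps_zero : fps A := Fps (fun _ => 0).
Definition fps_opp f : fps A := Fps (fun n => - f n).
Definition fps_add f g : fps A := Fps (fun n => f n + g n).
Definition fps_const (a : A) : fps A := Fps (fun n => if n is 0%N then a else 0).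
Definition fps_X : fps A := Fps (fun n => (n == 1%N)%:R).
Definition fps_mul f g : fps A :=
  Fps (fun n => \sum_(i < n.+1) f i * g (n - i)%N).

Fact fps_addA : associative fps_add.
Proof. by move=> f g h; apply/fpsP => n /=; rewrite addrA. Qed.
Fact fps_addC : commutative fps_add.
Proof. by move=> f g; apply/fpsP => n /=; rewrite addrC. Qed.
Fact fps_add0 : left_id fps_zero fps_add.
Proof. by move=> f; apply/fpsP => n /=; rewrite add0r. Qed.
Fact fps_addN : left_inverse fps_zero fps_opp fps_add.
Proof. by move=> f; apply/fpsP => n /=; rewrite addNr. Qed.

HB.instance Definition _ :=
  GRing.isZmodule.Build (fps A) fps_addA fps_addC fps_add0 fps_addN.

Definition fps_trunc (N : nat) f : {poly A} := \poly_(i < N) f i.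

Lemma fps_mul_trunc N n f g : (n < N)%N ->
  fps_mul f g n = (fps_trunc N f * fps_trunc N g)`_n.
Proof.
move=> nN; rewrite coefM; apply: eq_bigr => i _; rewrite !coef_poly.
rewrite (leq_ltn_trans (leq_subr _ _) nN).
by rewrite (leq_ltn_trans _ nN) // -ltnS.
Qed.

Lemma fps_truncM N n f g : (n < N)%N ->
  (fps_trunc N (fps_mul f g))`_n = (fps_trunc N f * fps_trunc N g)`_n.
Proof. by move=> nN; rewrite coef_poly nN (fps_mul_trunc _ _ nN). Qed.

Fact fps_mulC : commutative fps_mul.
Proof.
by move=> f g; apply/fpsP => n; rewrite !(fps_mul_trunc _ _ (ltnSn n)) mulrC.
Qed.

Fact fps_mulA : associative fps_mul.
Proof.
move=> f g h; apply/fpsP => n; rewrite !(fps_mul_trunc _ _ (ltnSn n)).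
transitivity ((fps_trunc n.+1 f * (fps_trunc n.+1 g * fps_trunc n.+1 h))`_n).
  rewrite [LHS]coefM [RHS]coefM; apply: eq_bigr => i _.
  by rewrite fps_truncM // ltnS leq_subr.
rewrite mulrA [LHS]coefM [RHS]coefM; apply: eq_bigr => i _.
by rewrite fps_truncM.
Qed.

Fact fps_mul1 : left_id (fps_const 1) fps_mul.
Proof.
move=> f; apply/fpsP => n /=.
rewrite big_ord_recl /= mul1r subn0 big1 ?addr0 // => i _.
by rewrite mul0r.
Qed.

Fact fps_mulDl : left_distributive fps_mul +%R.
Proof.
move=> f g h; apply/fpsP => n /=; rewrite -big_split /=.
by apply: eq_bigr => i _; rewrite mulrDl.
Qed.

Fact fps_one_neq0 : fps_const 1 != 0.
Proof. by apply/eqP => /fpsP /(_ 0%N) /eqP; rewrite oner_eq0. Qed.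

HB.instance Definition _ := GRing.Zmodule_isComNzRing.Build (fps A)
  fps_mulA fps_mulC fps_mul1 fps_mulDl fps_one_neq0.

End Ring.

Section UnitRing.
Variable A : comUnitRingType.
Implicit Types f g h : fps A.

(* The first n coefficients of the inverse of f, from the recurrence          *)
(* f_0 g_n = - \sum_(i < n) f_(n-i) g_i.                                      *)
Fixpoint fps_inv_seq f (n : nat) : seq A :=
  if n is m.+1 then
    let s := fps_inv_seq f m in
    rcons s ((f 0%N)^-1 * ((m == 0%N)%:R - \sum_(i < m) f (m - i)%N * s`_i))
  else [::].

Definition fps_unit : pred (fps A) := fun f => f 0%N \is a GRing.unit.

(* As for all MathComp unit rings, the inverse of a non-unit is itself.       *)
Definition fps_inv f : fps A :=
  if fps_unit f then Fps (fun n => (fps_inv_seq f n.+1)`_n) else f.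

Lemma size_fps_inv_seq f n : size (fps_inv_seq f n) = n.
Proof. by elim: n => //= n IHn; rewrite size_rcons IHn. Qed.

Lemma nth_fps_inv_seq f n i : (i < n)%N ->
  (fps_inv_seq f n)`_i = (fps_inv_seq f i.+1)`_i.
Proof.
elim: n => // n IHn; rewrite ltnS leq_eqVlt => /predU1P[-> // | lt_in].
by rewrite [fps_inv_seq f n.+1]/= nth_rcons size_fps_inv_seq lt_in IHn.
Qed.

Fact fps_mulV : {in fps_unit, left_inverse 1 fps_inv *%R}.
Proof.
move=> f Uf; rewrite /fps_inv (Uf : fps_unit f); apply/fpsP => n.
rewrite [LHS]/= big_ord_recr /= subnn nth_rcons size_fps_inv_seq ltnn eqxx.
rewrite [_ * f 0%N]mulrC mulVKr //.
rewrite [X in _ + (_ - X)](eq_bigr (fun i : 'I_n =>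
  (fps_inv_seq f i.+1)`_i * f (n - i)%N)) => [|i _]; last first.
  by rewrite mulrC nth_fps_inv_seq.
by rewrite addrC subrK; case: n.
Qed.

Fact fps_unitPl f g : g * f = 1 -> fps_unit f.
Proof.
move=> /fpsP/(_ 0%N) /=; rewrite big_ord_recl big_ord0 addr0 /= => gf1.
by apply/unitrPr; exists (g 0%N); rewrite mulrC.
Qed.

Fact fps_inv_out : {in [predC fps_unit], fps_inv =1 id}.
Proof. by move=> f /negbTE Uf; rewrite /fps_inv (Uf : fps_unit f = false). Qed.

HB.instance Definition _ := GRing.ComNzRing_hasMulInverse.Build (fps A)
  fps_mulV fps_unitPl fps_inv_out.

End UnitRing.

End FormalPowerSeries.

Notation "''Z[[t,q]]'" := (fps (fps int)) (format "''Z[[t,q]]'").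

Definition tvar : 'Z[[t,q]] := fps_X (fps int).
Definition qvar : 'Z[[t,q]] := fps_const (fps_X int).

Lemma tvar_factor_unit (m : nat) (F : 'Z[[t,q]]) :
  0 < m -> (1 - tvar ^+ m * F)%R \is a GRing.unit.
Proof.
case: m => // m _.
rewrite -[_ \is a _]/((1 - tvar ^+ m.+1 * F)%R 0%N \is a GRing.unit).
have -> : (1 - tvar ^+ m.+1 * F)%R 0%N = (1 : fps int)%R.
  by rewrite exprS -mulrA /= big_ord_recl big_ord0 /= mul0r addr0; exact: erefl.
exact: unitr1.
Qed.

Definition qint (A : comNzRingType) (x : A) (m : nat) : A :=
  (\sum_(i < m) x ^+ i)%R.

(* \sum_(k >= 0) t^k P_k for a sequence P of power series in q alone.         *)
Definition tseries (P : nat -> fps int) : 'Z[[t,q]] := Fps P.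

Definition qfilter (p : nat) (F : 'Z[[t,q]]) : 'Z[[t,q]] :=
  Fps (fun k => Fps (fun i => if p %| i then F k i else 0%R)).

(* The group G(r,n).  For r > 0 the type of colors 'I_r.-1.+1 is {0,...,r-1}  *)
(* with addition modulo r.                                                    *)

Definition colperm (r n : nat) : Type :=
  ({ffun 'I_n -> 'I_r.-1.+1} * 'S_n)%type.

HB.instance Definition _ (r n : nat) := Finite.on (colperm r n).

Section ColoredPermutations.
Variables r n : nat.
Implicit Types x y z : colperm r n.

(* MathComp composes permutations from left to right: the paper's product     *)
(* tau sigma, which maps i to tau (sigma i), is (sigma * tau)%g here.         *)
Definition cp_mul x y : colperm r n :=
  ([ffun i => (y.1 i + x.1 (y.2 i))%R], (y.2 * x.2)%g).

Definition cp_one : colperm r n := ([ffun=> 0%R], 1%g).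

Definition cp_inv x : colperm r n :=
  ([ffun i => (- x.1 ((x.2)^-1%g i))%R], (x.2)^-1%g).

Fact cp_mulA : associative cp_mul.
Proof.
move=> [c s] [d t] [e u]; congr (_, _) => /=; last by rewrite mulgA.
by apply/ffunP=> i; rewrite !ffunE /= permM addrA.
Qed.

Fact cp_mul1 : left_id cp_one cp_mul.
Proof.
move=> [c s]; congr (_, _) => /=; last by rewrite mulg1.
by apply/ffunP=> i; rewrite !ffunE addr0.
Qed.

Fact cp_mulV : left_inverse cp_one cp_inv cp_mul.
Proof.
move=> [c s]; congr (_, _) => /=; last by rewrite mulgV.
by apply/ffunP=> i; rewrite !ffunE permK subrr.
Qed.

HB.instance Definition _ :=
  Finite_isGroup.Build (colperm r n) cp_mulA cp_mul1 cp_mulV.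

Definition Grpn (p : nat) : {set colperm r n} :=
  [set x : colperm r n | p %| \sum_(i < n) (x.1 i : nat)].

Definition Cgen (s : nat) : colperm r n := ([ffun=> inZp (r %/ s)], 1%g).

End ColoredPermutations.

Definition Cs (r n s : nat) : {group colperm r n} := <[Cgen r n s]>%G.

Lemma cpM r n (x y : colperm r n) :
  (x * y)%g = ([ffun i => (y.1 i + x.1 (y.2 i))%R], (y.2 * x.2)%g).
Proof. by []. Qed.

Lemma cp1 r n : (1%g : colperm r n) = ([ffun=> 0%R], 1%g).
Proof. by []. Qed.

Lemma Grpn_group_set r p n : 0 < r -> p %| r -> group_set (Grpn r n p).
Proof.
move=> r0 pr; apply/group_setP; split.
  by rewrite inE big1 ?dvdn0 // => i _; rewrite ffunE.
move=> x y; rewrite !inE => px py; rewrite cpM /=.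
have rE : r.-1.+1 = r by rewrite prednK.
have modp a : (a %% r.-1.+1) = a %[mod p] by rewrite rE modn_dvdm.
rewrite /dvdn.
have -> : (\sum_(i < n) ([ffun i => (y.1 i + x.1 (y.2 i))%R] i : nat)) =
   (\sum_(i < n) (y.1 i : nat) + \sum_(i < n) (x.1 i : nat)) %[mod p].
  rewrite [X in _ + X](reindex_inj (@perm_inj _ y.2)) -big_split /=.
  elim/big_ind2: _ => // [a b c d e f|i _].
    by rewrite -modnDm e f modnDm.
  by rewrite ffunE /= modp.
by rewrite -/(dvdn _ _) dvdn_add.
Qed.

Lemma Cs_central r n s : (Cs r n s \subset 'C([set: colperm r n]))%g.
Proof.
rewrite cycle_subG; apply/centP => y _.
rewrite /commute !cpM /=; congr pair; rewrite ?mulg1 ?mul1g //.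
by apply/ffunP=> i; rewrite !ffunE perm1 addrC.
Qed.

Lemma Cs_sub r p s n : 0 < r -> 0 < s -> s %| r -> p %| r ->
  p * s %| r * n -> Cs r n s \subset Grpn r n p.
Proof.
move=> r0 s0 sr pr psr.
rewrite -[Grpn r n p]/(gval (Group (Grpn_group_set n r0 pr))) cycle_subG inE /=.
under eq_bigr do rewrite ffunE /=.
rewrite sum_nat_const card_ord prednK //.
apply: (@dvdn_trans (n * (r %/ s))).
  by rewrite -(@dvdn_pmul2r s) // -mulnA divnK // mulnC mulnC [n * r]mulnC.
have [->|s1] := eqVneq s 1.
  by rewrite divn1 modnn muln0 dvdn0.
by rewrite modn_small // ltn_Pdiv // ltn_neqAle eq_sym s1.
Qed.

(* The elements of G(r,p,s,n), as a subset of the type of cosets of C_s.      *)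
Definition Grpsn (r p s n : nat) : {set coset_of (Cs r n s)} :=
  (Grpn r n p / Cs r n s)%g.

Definition residue (m : nat) (i : int) : nat := `|(i %% m%:Z)%Z|%N.

(* Positions and values are numbered from 0 to n-1, so for 1 <= i <= n        *)
(* c_i = color x i.-1 and sigma(i) = (cp_perm x i.-1).+1.                     *)

Section Statistics.
Variables r n : nat.
Implicit Type x : colperm r n.

Definition color x (i : nat) : nat :=
  if insub i is Some j then x.1 (j : 'I_n) else 0.

Definition cp_perm x (i : nat) : nat :=
  if insub i is Some j then x.2 (j : 'I_n) else 0.

Definition HDes x : {set 'I_n} :=
  [set i : 'I_n | [&& i.+1 < n, color x i == color x i.+1
                    & cp_perm x i.+1 < cp_perm x i]].

Definition hstat x (i : nat) : nat := #|[set j in HDes x | i <= j]|.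

(* [kstat_rev s x d] is k at the position n-1-d. *)
Fixpoint kstat_rev (s : nat) x (d : nat) : nat :=
  if d is e.+1 then
    kstat_rev s x e
      + residue r ((color x (n.-1 - d))%:Z - (color x (n.-1 - e))%:Z)%R
  else residue (r %/ s) (color x n.-1)%:Z.

Definition kstat s x (i : nat) : nat := kstat_rev s x (n.-1 - i).

Definition lambda s x (i : nat) : nat := r * hstat x i + kstat s x i.

Definition fmaj_rep s x : nat := \sum_(i < n) lambda s x i.

(* There is no truncation in the subtraction when s <= r. *)
Definition des_rep s x : nat := (s * lambda s x 0 + r - s) %/ r.

End Statistics.

Lemma color_shift r n s (x : colperm r n) i : 0 < r -> i < n ->
  color (x * Cgen r n s)%g i = (color x i + r %/ s) %% r.
Proof.
case: r x => // r x _ lin; rewrite /color !insubT cpM /= !ffunE /= perm1.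
by rewrite modnDml addnC.
Qed.

Lemma color_lt r n (x : colperm r n) i : 0 < r -> color x i < r.
Proof. by case: r x => // r x _; rewrite /color; case: insub => // a. Qed.

Lemma cp_perm_shift r n s (x : colperm r n) k :
  cp_perm (x * Cgen r n s)%g k = cp_perm x k.
Proof.
rewrite /cp_perm; case: (insub k : option 'I_n) => [u|] //.
by rewrite cpM /= mul1g.
Qed.

Lemma lambda_shift r n s (x : colperm r n) i :
  0 < r -> 0 < n -> s %| r ->
  lambda s (x * Cgen r n s)%g i = lambda s x i.
Proof.
move=> r0 n0 sr; rewrite /lambda; congr (_ * _ + _).
  rewrite /hstat; apply: eq_card => j; rewrite !inE.
  case: (ltnP j.+1 n) => //= jn; rewrite !color_shift //.
  by rewrite eqn_modDr !modn_small ?color_lt // !cp_perm_shift.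
rewrite /kstat; elim: (n.-1 - i) => [|d IH] /=.
  rewrite color_shift // ?prednK // /residue !modz_nat /=.
  by rewrite modn_dvdm ?modnDr // dvdn_div.
have lt_n a : n.-1 - a < n by rewrite -[ltnRHS](prednK n0) ltnS leq_subr.
rewrite IH !color_shift //.
congr (_ + _); rewrite /residue; congr absz; rewrite -!modz_nat.
rewrite -modzDml modz_mod modzDml -modzDmr -modzNm modz_mod modzNm modzDmr !PoszD.
by congr ((_ %% _)%Z); rewrite opprD addrACA subrr addr0.
Qed.

(* By [lambda_shift] the choice of the representative [repr g] is irrelevant. *)

Definition fmaj (r n s : nat) (g : coset_of (Cs r n s)) : nat :=
  fmaj_rep s (repr g).

Definition des (r n s : nat) (g : coset_of (Cs r n s)) : nat :=
  des_rep s (repr g).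

(* Main.v *)
Require Import Defs.
From mathcomp Require Import all_boot all_order all_algebra all_fingroup.
From mathcomp Require Import zify ring.

(* The coefficient of t^K on the left enumerates by sum the words f of length *)
(* n over {0,...,(r/s)K} whose sum is divisible by p.  Sorting f decreasingly, *)
(* ties broken by increasing position, yields a permutation sigma, and the     *)
(* residues of f modulo r then yield colors; for the resulting g there are     *)
(* unique v_1,...,v_n >= 0 such that                                           *)
(*   f(sigma(i)) = lambda_i(g) + r (v_i + ... + v_(n-1)) + (r/s) v_n.          *)
(* This is a bijection between words and pairs (g, v) with g in G(r,p,s,n).    *)
(* The sum of f is fmaj(g) + r \sum_(j < n) j v_j + n (r/s) v_n, and f is      *)
(* bounded by (r/s)K iff des(g) + s (v_1 + ... + v_(n-1)) + v_n <= K: on the   *)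
(* right, v_j is the exponent in the geometric series of the j-th factor, and  *)
(* 1/(1-t) turns equality with K into the inequality.                          *)

(** The bijection rests on [level_step]: consecutive entries of the sorted word differ by
    [r * (hdescent x i + v i)] plus a residue below [r]. Euclidean division of the gaps by [r]
    therefore recovers the color differences and the [v i], and the descent term forces a strict
    drop exactly where a tie would contradict the tie-breaking rule. Dividing the last entry by
    [r %/ s] gives [v n]; the colors are determined only up to a common multiple of [r %/ s], that
    is, up to [Cs]. [word_sorted], [word_inj] and [word_surj] establish the bijection; [fmaj_word],
    [word_dvd] and [des_word] translate the sum, its divisibility by [p] and the bound on the
    entries. [sum_words] packages this as an equality of finite sums, which the theorem uses for
    each coefficient of [t^K]. *)

Set Implicit Arguments.
Unset Strict Implicit.
Unset Printing Implicit Defensive.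

Import GRing.Theory.
Local Open Scope ring_scope.

(** * Coefficients of power series and truncated geometric series *)

Section PowerSeries.
Variable A : comNzRingType.
Implicit Types (F G : fps A) (c : A).

Lemma fcoefM F G k : (F * G) k = \sum_(i < k.+1) F i * G (k - i)%N.
Proof. by []. Qed.

Lemma fcoefD F G k : (F + G) k = F k + G k.
Proof. by []. Qed.

Lemma fcoef_sum (I : Type) (r : seq I) (P : pred I) (E : I -> fps A) k :
  (\sum_(i <- r | P i) E i) k = \sum_(i <- r | P i) E i k.
Proof. exact: (big_morph (fun F : fps A => F k)). Qed.

Lemma fcoefXM F k : (fps_X A * F) k = if k is k'.+1 then F k' else 0.
Proof.
rewrite fcoefM big_ord_recl mul0r add0r.
case: k => [|k]; first by rewrite big_ord0.
rewrite big_ord_recl mul1r subSS subn0 big1 ?addr0 // => i _.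
by rewrite mul0r.
Qed.

Lemma fcoefXnM d F k :
  (fps_X A ^+ d * F) k = if (d <= k)%N then F (k - d)%N else 0.
Proof.
elim: d k => [|d IHd] k; first by rewrite mul1r subn0.
by rewrite exprS -mulrA fcoefXM; case: k => // k; rewrite IHd subSS.
Qed.

Lemma fcoefXn d k : (fps_X A ^+ d) k = (k == d)%:R.
Proof.
rewrite -[_ ^+ d]mulr1 fcoefXnM -[1]/(fps_const 1).
case: leqP => [le_dk|lt_kd]; last by rewrite ltn_eqF.
by rewrite /= -[k == d]/(k == d)%N eqn_leq le_dk andbT -subn_eq0; case: (k - d)%N.
Qed.

Lemma fps_constX c e : fps_const c ^+ e = fps_const (c ^+ e).
Proof.
elim: e => // e IHe; rewrite !exprS IHe; apply/fpsP => k.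
rewrite fcoefM big_ord_recl subn0 big1 ?addr0 => [|i _]; last by rewrite mul0r.
by case: k => //= k; rewrite mulr0.
Qed.

Definition eq_upto K F G := forall k, (k <= K)%N -> F k = G k.

Lemma eq_uptoM K F F' G G' :
  eq_upto K F F' -> eq_upto K G G' -> eq_upto K (F * G) (F' * G').
Proof.
move=> eqF eqG k le_kK; rewrite !fcoefM; apply: eq_bigr => i _.
have le_ik : (i <= k)%N by rewrite -ltnS.
by rewrite eqF ?eqG // (leq_trans _ le_kK) ?leq_subr.
Qed.

End PowerSeries.

(** The error of the truncated series is a multiple of [u ^+ K.+1], whose order is at least
    [a * K.+1 > K]. *)
Lemma geometric_upto (A : comUnitRingType) (K a : nat) (F : fps A) :
  (0 < a)%N -> let u := fps_X A ^+ a * F in 1 - u \is a GRing.unit ->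
  eq_upto K (1 - u)^-1 (\sum_(v < K.+1) u ^+ v).
Proof.
move=> a_gt0 u Uu k le_kK.
have /(canRL (mulKr Uu)) -> : (1 - u) * \sum_(v < K.+1) u ^+ v = 1 - u ^+ K.+1.
  by rewrite -[in RHS](expr1n _ K.+1) subrXX; congr (_ * _);
     apply: eq_bigr => i _; rewrite expr1n mul1r.
rewrite mulrBr mulr1 /u exprMn -exprM mulrCA fcoefD -[in LHS](addr0 ((1 - u)^-1 k)).
congr (_ + _); rewrite -mulrN fcoefXnM leqNgt.
by rewrite (leq_trans _ (leq_pmull K.+1 a_gt0)) // ltnS.
Qed.

Local Open Scope nat_scope.

(** * Existence and uniqueness of sorting permutations *)

Section SortingPermutation.
Variables (n : nat) (key : 'I_n -> nat).

Definition rank a := #|[set b | key a < key b]|.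

Lemma card_ltn_ord m : m <= n -> #|[set i : 'I_n | i < m]| = m.
Proof.
move=> le_mn; rewrite -sum1_card; under eq_bigl do rewrite inE.
by rewrite -(big_ord_widen _ (fun=> 1)) // sum1_card card_ord.
Qed.

(** The elements with a larger key than [sg i] are exactly the images of the indices below [i].
    Hence the inverse of [sg] is given by [rank], which yields uniqueness. *)
Lemma sorting_perm_rank (sg : 'S_n) :
  (forall i j : 'I_n, i < j -> key (sg j) < key (sg i)) ->
  forall i, rank (sg i) = i.
Proof.
move=> decr i; rewrite -[RHS](@card_ltn_ord i) ?(ltnW (ltn_ord i)) //.
rewrite -(card_imset _ (@perm_inj _ sg)); apply: eq_card => b.
rewrite -(permKV sg b) mem_imset ?inE; last exact: perm_inj.
case: (ltngtP (sg^-1%g b) i) => [/decr //|/decr|/val_inj->].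
- by move=> /ltnW; rewrite leqNgt => /negbTE.
- by rewrite ltnn.
Qed.

Lemma sorting_perm_unique (sg tau : 'S_n) :
  (forall i j : 'I_n, i < j -> key (sg j) < key (sg i)) ->
  (forall i j : 'I_n, i < j -> key (tau j) < key (tau i)) -> sg = tau.
Proof.
move=> /sorting_perm_rank sgP /sorting_perm_rank tauP; apply/permP => i.
have /permP/(_ (sg i)) : sg^-1%g = tau^-1%g.
  apply/permP => a; apply: val_inj.
  by rewrite /= -sgP -tauP !permKV.
by rewrite permK => eq_i; rewrite [in RHS]eq_i permKV.
Qed.

Lemma sorting_perm_exists : injective key ->
  {sg : 'S_n | forall i j : 'I_n, i < j -> key (sg j) < key (sg i)}.
Proof.
move=> key_inj.
have rank_lt a : rank a < n.
  rewrite -[ltnRHS](card_ord n) -cardsT; apply/proper_card/properP.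
  by split; [exact: subsetT | exists a; rewrite !inE ?ltnn].
have rank_mono a b : key a < key b -> rank b < rank a.
  move=> lt_ab; apply/proper_card/properP; split.
    by apply/subsetP => c; rewrite !inE; apply: ltn_trans.
  by exists b; rewrite !inE ?ltnn.
have rank_inj : injective (fun a => Ordinal (rank_lt a)).
  move=> a b [] eq_ab; apply: key_inj.
  by case: (ltngtP (key a) (key b)) => // /rank_mono; rewrite eq_ab ltnn.
exists (perm rank_inj)^-1%g => i j lt_ij.
set sg := (_^-1)%g.
have rankE k : rank (sg k) = k.
  by rewrite -[in RHS](permKV (perm rank_inj) k) permE.
case: (ltngtP (key (sg j)) (key (sg i))) => // [/rank_mono|/key_inj/perm_inj eq_ij].
  by rewrite !rankE ltnNge (ltnW lt_ij).
by rewrite eq_ij ltnn in lt_ij.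
Qed.

End SortingPermutation.

(* Decreasing order of [lex_key f] sorts by decreasing value of [f], breaking *)
(* ties by increasing position.                                               *)
Definition lex_key n (f : 'I_n -> nat) (a : 'I_n) := f a * n + (n - a.+1).

Lemma lex_keyP n (f : 'I_n -> nat) a b :
  (lex_key f b < lex_key f a) = (f b < f a) || (f b == f a) && (a < b).
Proof.
rewrite /lex_key; have := ltn_ord a; have := ltn_ord b => ltb lta.
case: (ltngtP (f b) (f a)) => [lt_ba|lt_ab|->] /=; [| |lia].
  have := leq_mul lt_ba (leqnn n); rewrite mulSn; lia.
have := leq_mul lt_ab (leqnn n); rewrite mulSn; lia.
Qed.

Lemma lex_key_inj n (f : 'I_n -> nat) : injective (lex_key f).
Proof.
move=> a b eq_ab; apply: val_inj.
have := lex_keyP f a b; have := lex_keyP f b a; rewrite eq_ab ltnn.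
by case: ltngtP => //=; case: (ltngtP (val a) (val b)).
Qed.

Lemma decreasing_ord n (P : 'I_n.+1 -> nat) :
  (forall i : nat, i < n -> P (inord i.+1) < P (inord i)) ->
  forall i j : 'I_n.+1, i < j -> P j < P i.
Proof.
move=> step i j lt_ij; rewrite -(inord_val i) -(inord_val j).
have := ltn_ord j; elim: (nat_of_ord j) lt_ij => // k IHk.
rewrite !ltnS leq_eqVlt => /orP[/eqP eq_ik|lt_ik] ltkn.
  by rewrite eq_ik step.
by apply: ltn_trans (step _ ltkn) (IHk lt_ik _); apply: ltnW.
Qed.

(** [kstat] and [level] are anchored at the last position, so facts about them propagate
    downwards. *)
Lemma down_ind (P : nat -> Prop) n :
  P n -> (forall i, i < n -> P i.+1 -> P i) -> forall i, i <= n -> P i.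
Proof.
move=> Pn step i le_in; rewrite -(subKn le_in).
elim: (n - i) => [|d IHd]; first by rewrite subn0.
case: (ltnP d n) => [lt_dn|le_nd].
  by apply: step; rewrite ?subnSK //; lia.
by rewrite (_ : n - d.+1 = n - d) //; lia.
Qed.

Lemma residueP r c d : 0 < r -> residue r (c%:Z - d%:Z)%R + d = c %[mod r].
Proof.
move=> r_gt0; suff : Posz ((residue r (c%:Z - d%:Z)%R + d) %% r) = (c %% r)%N.
  by case.
rewrite -!modz_nat PoszD /residue gez0_abs ?modz_ge0 -?lt0n //.
by rewrite modzDml subrK.
Qed.

Lemma residue_lt r z : 0 < r -> residue r z < r.
Proof.
move=> r_gt0; rewrite -ltz_nat /residue gez0_abs ?modz_ge0 ?ltz_pmod //.
by case: r r_gt0.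
Qed.

Lemma residue_nat m c : residue m c%:Z = c %% m.
Proof. by rewrite /residue modz_nat. Qed.

(** * Correspondence between words and colored permutations with exponents *)

Section Words.
Variables r s n : nat.
Hypotheses (r_gt0 : 0 < r) (s_gt0 : 0 < s) (s_dvd_r : s %| r).
Implicit Types (x y : colperm r n.+1) (v w : nat -> nat).

Local Notation m := (r %/ s).

Let m_gt0 : 0 < m. Proof. by rewrite divn_gt0 // dvdn_leq. Qed.

Let mulms : m * s = r. Proof. exact: divnK. Qed.

Lemma colorE x (i : 'I_n.+1) : color x i = x.1 i.
Proof. by rewrite /color valK. Qed.

Lemma cp_permE x (i : 'I_n.+1) : cp_perm x i = x.2 i.
Proof. by rewrite /cp_perm valK. Qed.

Lemma cp_perm_inord x i : i <= n -> cp_perm x i = x.2 (inord i).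
Proof. by move=> le_in; rewrite -cp_permE inordK. Qed.

Definition hdescent x i :=
  (color x i == color x i.+1) && (cp_perm x i.+1 < cp_perm x i).

Lemma hstat_step x i : i < n -> hstat x i = hstat x i.+1 + hdescent x i.
Proof.
move=> lt_in; have iK : (inord i : 'I_n.+1) = i :> nat by apply: inordK; apply: ltnW.
rewrite /hstat (cardsD1 (inord i)) addnC !inE iK ltnS lt_in leqnn andbT.
congr (_ + _); apply: eq_card => j; rewrite !inE -val_eqE /= iK.
by rewrite (ltn_neqAle i j) eq_sym andbCA.
Qed.

Lemma hstat_last x : hstat x n = 0.
Proof.
apply/eqP; rewrite cards_eq0; apply/eqP/setP => j; rewrite !inE.
by rewrite ltnS ltnNge; case: (n <= j); rewrite ?andbF.
Qed.

Lemma kstat_step x i : i < n ->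
  kstat s x i = kstat s x i.+1
                + residue r ((color x i)%:Z - (color x i.+1)%:Z)%R.
Proof.
move=> lt_in; rewrite /kstat /= -(subnSK lt_in) /= (subnSK lt_in).
by rewrite !subKn // ltnW.
Qed.

Lemma lambda_step x i : i < n ->
  lambda s x i = lambda s x i.+1 + r * hdescent x i
                 + residue r ((color x i)%:Z - (color x i.+1)%:Z)%R.
Proof.
move=> lt_in; rewrite /lambda hstat_step // kstat_step // mulnDr.
by rewrite -!addnA; congr (_ + _); rewrite addnCA.
Qed.

Lemma lambda_last x : lambda s x n = color x n %% m.
Proof. by rewrite /lambda hstat_last muln0 /kstat subnn /= residue_nat. Qed.

Lemma Cgen_shift x k :
  [/\ forall i, i <= n -> color (x * Cgen r n.+1 s ^+ k)%g i
                          = (color x i + k * m) %% r,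
      (x * Cgen r n.+1 s ^+ k)%g.2 = x.2
    & forall i, lambda s (x * Cgen r n.+1 s ^+ k)%g i = lambda s x i].
Proof.
elim: k => [|k [IHc IHp IHl]].
  by rewrite expg0 mulg1; split=> // i _; rewrite addn0 modn_small ?color_lt.
rewrite expgSr mulgA; split=> [i le_in||i].
- by rewrite color_shift // IHc // modnDml mulSn addnAC addnA.
- by rewrite -IHp [in LHS]cpM /= mul1g.
- by rewrite lambda_shift // IHl.
Qed.

(** This is the entry in place [i] of the word once sorted decreasingly. *)
Definition level x v i := lambda s x i + r * \sum_(i <= j < n) v j + m * v n.

Lemma level_step x v i : i < n ->
  level x v i = level x v i.+1 + r * (hdescent x i + v i)
                + residue r ((color x i)%:Z - (color x i.+1)%:Z)%R.
Proof.
move=> lt_in; rewrite /level lambda_step // (big_ltn lt_in) !mulnDr; lia.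
Qed.

Lemma level_last x v : level x v n = color x n %% m + m * v n.
Proof. by rewrite /level lambda_last big_geq // muln0 addn0. Qed.

(** The steps between levels match the color differences modulo [r]; only the last level, which sees
    its color modulo [m], leaves a common shift undetermined. *)
Lemma level_color x v :
  exists a, forall i, i <= n -> level x v i = color x i + a * m %[mod r].
Proof.
(* Modulo [r], the factor [(s - 1) * m] acts as [- m]: the second term compensates for the multiple
   of [m] removed by [color x n %% m]. *)
exists (v n + (s - 1) * (color x n %/ m)); apply: down_ind => [|i lt_in IHi].
  rewrite level_last; have := divn_eq (color x n) m.
  move: (color x n %/ m) (color x n %% m) => q e ->.
  rewrite (_ : _ + _ * m = q * r + (e + m * v n)) ?modnMDl //.
  have := mulms; move: (r %/ s) => k <-.
  by case: s s_gt0 => // s' _; rewrite subn1 /=; ring.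
rewrite level_step // addnAC addnC (mulnC r) modnMDl -modnDml IHi // modnDml.
by rewrite addnAC -modnDml (addnC _ (residue _ _)) residueP // modnDml.
Qed.

Definition word x v (k : 'I_n.+1) := level x v (x.2^-1%g k).

Lemma word_perm x v (i : 'I_n.+1) : word x v (x.2 i) = level x v i.
Proof. by rewrite /word permK. Qed.

Lemma level_le x v i : i < n -> level x v i.+1 <= level x v i.
Proof. by move=> lt_in; rewrite (level_step _ _ lt_in) -addnA leq_addr. Qed.

(** If two neighbouring levels agree, both the residue and the descent term vanish: the colors are
    equal and [x.2] increases there, as the tie-breaking requires. *)
Lemma word_sorted x v (i j : 'I_n.+1) :
  i < j -> lex_key (word x v) (x.2 j) < lex_key (word x v) (x.2 i).
Proof.
apply: (decreasing_ord (P := fun i => lex_key (word x v) (x.2 i))).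
move=> {i j} i lt_in; rewrite lex_keyP !word_perm !inordK ?ltnS ?(ltnW lt_in) //.
have := level_le x v lt_in; rewrite leq_eqVlt orbC.
case/orP=> [-> //|/eqP eq_lev]; rewrite eq_lev eqxx ltnn /=.
have := residueP (color x i) (color x i.+1) r_gt0; move: eq_lev.
rewrite (level_step _ _ lt_in); case: (residue _ _) => [|d]; last by lia.
move=> eq_lev; rewrite add0n !modn_small ?color_lt // => eq_c.
have : hdescent x i = false.
  by move: eq_lev; case: hdescent => //; rewrite addn0 mulnDr muln1; lia.
rewrite /hdescent eq_c eqxx /= !cp_perm_inord //; last exact: ltnW.
case: ltngtP => // /val_inj/perm_inj/(congr1 val) /=.
by rewrite !inordK ?ltnS ?(ltnW lt_in) //; lia.
Qed.

(** For [j < n], the exponent [v j] enters the levels [0] to [j], hence is counted [j.+1] times;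
    [v n] enters all [n.+1] levels. *)
Lemma fmaj_word x v :
  \sum_k word x v k
  = fmaj_rep s x + (r * \sum_(j < n) j.+1 * v j + n.+1 * m * v n).
Proof.
rewrite (reindex_perm x.2) (eq_bigr (fun i : 'I_n.+1 =>
  lambda s x i + (r * \sum_(i <= j < n) v j + m * v n))); last first.
  by move=> i _; rewrite word_perm /level addnA.
rewrite [LHS]big_split; congr (_ + _); rewrite [LHS]big_split; congr (_ + _).
  rewrite -big_distrr; congr (_ * _).
  rewrite (eq_bigr (fun i : 'I_n.+1 => \sum_(j < n | i <= j) v j)); last first.
    by move=> i _; rewrite big_geq_mkord.
  rewrite (exchange_big_dep predT) //; apply: eq_bigr => j _.
  have /card_ltn_ord cardE : j.+1 <= n.+1 by apply: ltnW; rewrite ltnS.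
  rewrite sum_nat_const -[in RHS]cardE; congr (_ * _).
  by apply: eq_card => i; rewrite inE.
by rewrite sum_nat_const card_ord mulnA.
Qed.

(** By [level_color] the two sums differ modulo [p] by a multiple of [n.+1 * m]. *)
Lemma word_dvd p x v : p %| r -> p %| n.+1 * m ->
  (p %| \sum_k word x v k) = (p %| \sum_k (x.1 k : nat)).
Proof.
move=> p_r p_nm; have [a aP] := level_color x v.
rewrite (reindex_perm x.2) /=; under eq_bigr do rewrite word_perm.
rewrite -[RHS](dvdn_addl _ (dvdn_mull a p_nm)) /dvdn; congr (_ == _).
rewrite mulnCA -[X in _ + X * _](card_ord n.+1) -sum_nat_const -big_split /=.
elim/big_ind2: _ => // [b c d e eq_bc eq_de|i _].
  by rewrite -modnDm eq_bc eq_de modnDm.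
rewrite -(modn_dvdm _ p_r) aP ?modn_dvdm ?colorE //.
by rewrite -ltnS.
Qed.

(** Level [0] is the largest entry and [des_rep] is the ceiling of [lambda s x 0 / m]; since
    [r = m * s], dividing the bound by [m] gives the inequality. *)
Lemma des_word K x v :
  [forall k, word x v k <= m * K]
  = (des_rep s x + (s * \sum_(j < n) v j + v n) <= K).
Proof.
have lev0 i : i <= n -> level x v i <= level x v 0.
  elim: i => // i IHi lt_in; apply: leq_trans (level_le _ _ lt_in) (IHi _).
  exact: ltnW.
transitivity (level x v 0 <= m * K).
  apply/forallP/idP => [/(_ (x.2 ord0))|le_mK k]; first by rewrite word_perm.
  by apply: leq_trans (lev0 _ _) le_mK; rewrite -ltnS.
rewrite /level big_mkord /des_rep; set l := lambda s x 0; set S := \sum_(j < n) _.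
rewrite -[in r * S]mulms.
have -> : (s * l + r - s) %/ r = (l + m - 1) %/ m.
  rewrite -[in LHS]mulms (mulnC m) -mulnDr -[X in _ - X]muln1 -mulnBr.
  by rewrite divnMl.
rewrite [in RHS]addnC -divnMDl // -[RHS]ltnS ltn_divLR // mulSn.
by move: (r %/ s) m_gt0 => k; nia.
Qed.

Lemma word_shift x v k : word (x * Cgen r n.+1 s ^+ k)%g v = word x v.
Proof.
have [_ eq_p eq_l] := Cgen_shift x k.
by apply/boolp.funext => i; rewrite /word /level eq_p eq_l.
Qed.

Lemma eq_word x v w : (forall i, i <= n -> v i = w i) -> word x v = word x w.
Proof.
move=> eq_vw; apply/boolp.funext => k; rewrite /word /level eq_vw //.
congr (_ + _ * _ + _); apply: eq_big_nat => j /andP[_ lt_jn].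
by rewrite eq_vw // ltnW.
Qed.

(** Uniqueness of the sorting permutation gives [x.2 = y.2], so the levels agree. They fix the
    colors up to a common shift, hence [lambda], and then the tail sums of the exponents. *)
Lemma word_inj x y v w : word x v = word y w ->
  (exists k, y = (x * Cgen r n.+1 s ^+ k)%g) /\ {in gtn n.+1, v =1 w}.
Proof.
move=> eq_xy.
have eq_p : x.2 = y.2.
  apply: (sorting_perm_unique (@word_sorted x v)).
  by rewrite eq_xy; apply: word_sorted.
have eq_lev i : i <= n -> level x v i = level y w i.
  move=> le_in; have := word_perm x v (inord i).
  by rewrite eq_xy eq_p word_perm inordK.
have [a aP] := level_color x v; have [b bP] := level_color y w.
(* The shift should be [a - b]; as [s * m = r], the term [(s - 1) * b] replaces [- b]. *)
pose k := a + (s - 1) * b.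
have [eq_c eq_q eq_l] := Cgen_shift x k.
have eq_y : y = (x * Cgen r n.+1 s ^+ k)%g.
  rewrite [y]surjective_pairing [RHS]surjective_pairing eq_q eq_p.
  congr (_, _); apply/ffunP => i; apply: val_inj.
  have le_in : i <= n by rewrite -ltnS.
  have := eq_c i le_in; rewrite !colorE /= => ->.
  have eq_xy_mod : color y i + b * m = color x i + a * m %[mod r].
    by rewrite -aP // -bP // eq_lev.
  rewrite -colorE -[LHS](modn_small (color_lt y i r_gt0)) -(modnMDl b).
  rewrite (_ : b * r + _ = color y i + b * m + (s - 1) * b * m); last first.
    have := mulms; move: (color y i) (r %/ s) => c e <-.
    by case: s s_gt0 => // s' _; rewrite subn1 /=; ring.
  by rewrite -modnDml eq_xy_mod modnDml /k mulnDl addnA colorE.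
split; first by exists k.
have eq_lam i : lambda s x i = lambda s y i by rewrite eq_y eq_l.
have eq_vn : v n = w n.
  have := eq_lev n (leqnn n); rewrite /level !big_geq // eq_lam.
  by move/addnI/eqP; rewrite eqn_pmul2l // => /eqP.
have eq_sum i : i <= n -> \sum_(i <= j < n) v j = \sum_(i <= j < n) w j.
  move=> /eq_lev; rewrite /level eq_lam eq_vn => /addIn/addnI/eqP.
  by rewrite eqn_pmul2l // => /eqP.
move=> i; rewrite inE ltnS leq_eqVlt => /predU1P[-> //|lt_in].
have := eq_sum i (ltnW lt_in).
by rewrite !(big_ltn lt_in) (eq_sum i.+1) // => /addIn.
Qed.

Lemma word_surj (f : 'I_n.+1 -> nat) : exists x v, word x v = f.
Proof.
have [sg sgP] := sorting_perm_exists (@lex_key_inj _ f).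
pose x : colperm r n.+1 := ([ffun i => inZp (f (sg i))], sg).
pose F i := f (sg (inord i)).
have colF i : i <= n -> color x i = F i %% r.
  move=> le_in; have := colorE x (inord i).
  by rewrite inordK // ffunE => -> /=; rewrite prednK.
(* These values are forced by [level_step] and [level_last]; [le_h] below shows that subtracting the
   descent does not truncate. *)
pose v i := if i < n then (F i - F i.+1) %/ r - hdescent x i else F n %/ m.
exists x, v.
suff eqF i : i <= n -> level x v i = F i.
  apply/boolp.funext => k; rewrite -(permKV sg k) -[sg]/(x.2) word_perm eqF.
    by rewrite /F inord_val.
  by rewrite -ltnS.
move: i; apply: down_ind => [|i lt_in IHi].
  have m_dvd_r : m %| r by rewrite -[X in _ %| X]mulms dvdn_mulr.
  rewrite level_last colF // modn_dvdm // /v ltnn.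
  by rewrite [RHS](divn_eq _ m) addnC mulnC.
have le_in := ltnW lt_in.
have := sgP (inord i) (inord i.+1); rewrite !inordK // lex_keyP => /(_ (leqnn _)).
rewrite -/(F i) -/(F i.+1) => sortF.
have := residueP (color x i) (color x i.+1) r_gt0.
rewrite level_step // IHi /v lt_in /hdescent !cp_perm_inord //=.
set d := residue _ _; have := residue_lt ((color x i)%:Z - (color x i.+1)%:Z)%R r_gt0.
rewrite -/d !colF // modnDmr modn_mod => lt_dr mod_d.
have leF : F i.+1 <= F i by case/orP: sortF => [/ltnW //|/andP[/eqP-> _]].
have def_d : (F i - F i.+1) %% r = d.
  rewrite -[RHS](modn_small lt_dr); apply/eqP.
  by rewrite -(eqn_modDr (F i.+1)) subnK // mod_d.
have := divn_eq (F i - F i.+1) r; rewrite def_d mulnC.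
(* At a descent, equal colors make [r] divide the gap, and the gap is positive because ties are
   sorted by increasing position; so the quotient is at least 1. *)
set h := nat_of_bool _; have le_h : h <= (F i - F i.+1) %/ r.
  rewrite /h; case: andP => // -[]; rewrite eqn_mod_dvd // => r_dvd lt_sg.
  rewrite divn_gt0 // dvdn_leq // subn_gt0.
  by case/orP: sortF => // /andP[_]; rewrite ltnNge (ltnW lt_sg).
by rewrite subnKC // -addnA => <-; rewrite subnKC.
Qed.

End Words.

(** * Passage to cosets of [Cs] and the resulting equality of sums *)

Section Cosets.
Variables r p s n : nat.
Hypotheses (r_gt0 : 0 < r) (s_gt0 : 0 < s).
Hypotheses (p_dvd_r : p %| r) (s_dvd_r : s %| r).
Hypothesis ps_dvd_rn : p * s %| r * n.+1.
Implicit Types (x : colperm r n.+1) (g : coset_of (Cs r n.+1 s)).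

Local Notation m := (r %/ s).

Let p_dvd_nm : p %| n.+1 * m.
Proof. by rewrite -(dvdn_pmul2r s_gt0) -mulnA divnK // mulnC [_ * r]mulnC mulnC. Qed.

Lemma Cs_norm x : x \in ('N(Cs r n.+1 s))%g.
Proof.
apply: (subsetP (cents_norm _)) (in_setT x).
by rewrite centsC; apply: Cs_central.
Qed.

Lemma coset_shift x k :
  coset (Cs r n.+1 s) (x * Cgen r n.+1 s ^+ k)%g = coset (Cs r n.+1 s) x.
Proof.
rewrite morphM ?Cs_norm //= [X in (_ * X)%g]coset_id ?mulg1 //.
exact: mem_cycle.
Qed.

Lemma repr_coset_shift x :
  exists k, repr (coset (Cs r n.+1 s) x) = (x * Cgen r n.+1 s ^+ k)%g.
Proof.
have := coset_reprK (coset (Cs r n.+1 s) x).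
case/kercoset_rcoset => [||z]; rewrite ?Cs_norm // => z_Cs ->.
have /cycleP[k ->] := z_Cs; exists k.
have /centP cent_k := subsetP (Cs_central r n.+1 s) _ (mem_cycle _ k).
by rewrite cent_k // inE.
Qed.

Lemma Grpn_dvd_word x v : (x \in Grpn r n.+1 p) = (p %| \sum_k word s x v k).
Proof. by rewrite word_dvd // inE. Qed.

Lemma mem_Grpsn g : (g \in Grpsn r p s n.+1) = (repr g \in Grpn r n.+1 p).
Proof.
apply/idP/idP => [/morphimP[x _ xG ->]|gG].
  have [k ->] := repr_coset_shift x; move: xG.
  (* Any exponents would serve: expressing membership through a word makes it invariant under
     shifts. *)
  by rewrite !(Grpn_dvd_word _ (fun=> 0)) word_shift.
by rewrite -[g]coset_reprK; apply: mem_morphim; rewrite ?Cs_norm.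
Qed.

(** Exponents bounded by [K] form a finite type and match the truncated geometric series. *)
Definition nat_fun K (v : {ffun 'I_n.+1 -> 'I_K.+1}) (i : nat) : nat := v (inord i).

(** [tweight] and [qweight] are the exponents of [t] and [q] in the denominator factors other than
    [1 - t]; index [n] is the factor with [t] to the first power. *)
Definition tweight (j : 'I_n.+1) := if j < n then s else 1.

Definition qweight (j : 'I_n.+1) := if j < n then j.+1 * r else n.+1 * m.

Lemma tweight_sum K (v : {ffun 'I_n.+1 -> 'I_K.+1}) :
  \sum_j tweight j * v j = s * \sum_(j < n) nat_fun v j + nat_fun v n.
Proof.
rewrite big_ord_recr /tweight /= ltnn mul1n -[ord_max]inord_val big_distrr.
congr (_ + _); apply: eq_bigr => j _ /=.
by rewrite ltn_ord /nat_fun -[widen_ord _ _]inord_val.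
Qed.

Lemma qweight_sum K (v : {ffun 'I_n.+1 -> 'I_K.+1}) :
  \sum_j qweight j * v j
  = r * \sum_(j < n) j.+1 * nat_fun v j + n.+1 * m * nat_fun v n.
Proof.
rewrite big_ord_recr /qweight /= ltnn -[ord_max]inord_val big_distrr.
congr (_ + _); apply: eq_bigr => j _ /=.
by rewrite ltn_ord /nat_fun -[widen_ord _ _]inord_val mulnA (mulnC r).
Qed.

Lemma sum_words (V : nmodType) (G : nat -> V) K :
  (\sum_(f : {ffun 'I_n.+1 -> 'I_(m * K).+1} | (p %| \sum_k f k)%N) G (\sum_k f k)%N
  = \sum_(g in Grpsn r p s n.+1)
      \sum_(v : {ffun 'I_n.+1 -> 'I_K.+1} | (des g + \sum_j tweight j * v j <= K)%N)
        G (fmaj g + \sum_j qweight j * v j)%N)%R.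
Proof.
(* On [A] the [inord] loses nothing, because [des_word] bounds the entries by [m * K]. *)
pose h (gv : coset_of (Cs r n.+1 s) * {ffun 'I_n.+1 -> 'I_K.+1}) :=
  [ffun k => inord (word s (repr gv.1) (nat_fun gv.2) k) : 'I_(m * K).+1].
pose A := [pred gv : coset_of (Cs r n.+1 s) * {ffun 'I_n.+1 -> 'I_K.+1} |
  (gv.1 \in Grpsn r p s n.+1) && (des gv.1 + \sum_j tweight j * gv.2 j <= K)].
have hE gv : gv \in A ->
    forall k, h gv k = word s (repr gv.1) (nat_fun gv.2) k :> nat.
  case: gv => g v /andP[_ /=]; rewrite tweight_sum /des -des_word //.
  by move=> /forallP le_mK k; rewrite /h ffunE inordK //= ltnS; apply: le_mK.
have h_inj : {in A &, injective h}.
  move=> [g v] [g' v'] /hE hgv /hE hgv' eq_h; move: hgv hgv'; rewrite eq_h /=.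
  move=> hgv hgv'.
  have [|[k eq_g] eq_v] := word_inj r_gt0 s_gt0 s_dvd_r
    (x := repr g) (y := repr g') (v := nat_fun v) (w := nat_fun v').
    by apply/boolp.funext => i; rewrite -hgv -hgv'.
  congr (_, _).
    by rewrite -(coset_reprK g) -(coset_reprK g') eq_g coset_shift.
  apply/ffunP => i; apply: val_inj.
  by have := eq_v i (ltn_ord i); rewrite /nat_fun inord_val.
rewrite pair_big_dep /= -[RHS]/(\sum_(gv in A) _)%R.
transitivity (\sum_(gv in A) G (\sum_k h gv k)%N)%R; last first.
  apply: eq_bigr => -[g v] gvA; rewrite (eq_bigr _ (fun k _ => hE _ gvA k)).
  by rewrite fmaj_word qweight_sum.
rewrite -(big_imset (fun f : {ffun _ -> 'I_(m * K).+1} => G (\sum_k f k)%N) h_inj).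
apply: eq_bigl => f; apply/idP/imsetP => [p_dvd_f|[[g v] gvA ->]]; last first.
  rewrite (eq_bigr _ (fun k _ => hE _ gvA k)) -Grpn_dvd_word -mem_Grpsn.
  by case/andP: gvA.
have [x [v eq_f]] := word_surj r_gt0 s_gt0 s_dvd_r (fun k => f k : nat).
pose g := coset (Cs r n.+1 s) x.
have {}eq_f : word s (repr g) v = (fun k => f k : nat).
  by have [k ->] := repr_coset_shift x; rewrite word_shift.
have le_K : des g + (s * \sum_(j < n) v j + v n) <= K.
  rewrite /des -des_word // eq_f; apply/forallP => k.
  by rewrite -ltnS.
(* Since [s > 0], the bound [le_K] already limits each exponent by [K]. *)
have v_lt i : i < n.+1 -> v i < K.+1.
  rewrite !ltnS leq_eqVlt => /predU1P[->|lt_in]; first by lia.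
  move: le_K; rewrite (bigD1 (Ordinal lt_in)) //= mulnDr.
  by have := leq_pmull (v i) s_gt0; lia.
pose v' : {ffun 'I_n.+1 -> 'I_K.+1} := [ffun i : 'I_n.+1 => inord (v i)].
have v'E i : i <= n -> nat_fun v' i = v i.
  by move=> le_in; rewrite /nat_fun ffunE !inordK ?v_lt.
have eq_w : word s (repr g) (nat_fun v') = word s (repr g) v.
  exact: eq_word.
have gvA : (g, v') \in A.
  apply/andP; split => /=.
    rewrite mem_Grpsn (Grpn_dvd_word _ v) eq_f; exact: p_dvd_f.
  rewrite tweight_sum v'E // (eq_bigr (fun j : 'I_n => v j)) // => j _.
  by rewrite v'E // ltnW.
exists (g, v') => //; apply/ffunP => k; apply: val_inj.
by rewrite /= hE //= eq_w eq_f.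
Qed.

End Cosets.

(** * Coefficient extraction and the generating function identity *)

Local Open Scope ring_scope.

Lemma qint_exp (A : comNzRingType) (x : A) N n :
  qint x N ^+ n = \sum_(f : {ffun 'I_n -> 'I_N}) x ^+ (\sum_k f k)%N.
Proof.
rewrite /qint -[X in _ ^+ X]card_ord -prodr_const bigA_distr_bigA.
by apply: eq_bigr => f _; rewrite prodrXr.
Qed.

Lemma fcoef_monomial d e k :
  (tvar ^+ d * qvar ^+ e) k = if k == d then fps_X int ^+ e else 0.
Proof.
rewrite fcoefXnM fps_constX eqn_leq andbC; case: leqP => //= le_dk.
by rewrite -subn_eq0; case: (k - d)%N.
Qed.

(** Only [l = K - d] contributes. The sum over [l] is the truncation of [1 / (1 - t)], which turns
    degree exactly [K] into degree at most [K]. *)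
Lemma fcoef_sum_tvar d e K :
  (\sum_(l < K.+1) tvar ^+ l * (tvar ^+ d * qvar ^+ e)) K
  = if (d <= K)%N then fps_X int ^+ e else 0.
Proof.
rewrite fcoef_sum (eq_bigr (fun l : 'I_K.+1 =>
  if (K == l + d)%N then fps_X int ^+ e else 0)); last first.
  by move=> l _; rewrite mulrA -exprD fcoef_monomial.
rewrite -big_mkcond; case: leqP => [le_dK|lt_Kd].
  rewrite (big_pred1 (inord (K - d))) // => l.
  by rewrite /= -val_eqE /= inordK ?ltnS ?leq_subr //; lia.
by rewrite big_pred0 // => l; lia.
Qed.

Theorem corollary5p3 (r p s n : nat)
    (r_gt0 : (0 < r)%N) (p_gt0 : (0 < p)%N) (s_gt0 : (0 < s)%N)
    (n_gt0 : (0 < n)%N)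
    (p_dvd_r : (p %| r)%N) (s_dvd_r : (s %| r)%N)
    (ps_dvd_rn : (p * s %| r * n)%N) :
  qfilter p (tseries (fun k => qint (fps_X int) (r %/ s * k + 1)%N ^+ n))
  = (\sum_(g in Grpsn r p s n) tvar ^+ des g * qvar ^+ fmaj g)
    / ((1 - tvar)
       * (\prod_(1 <= j < n) (1 - tvar ^+ s * qvar ^+ (j * r)))
       * (1 - tvar * qvar ^+ (n * r %/ s))).
Proof.
case: n n_gt0 ps_dvd_rn => // n _ ps_dvd_rn.
pose u (j : 'I_n.+1) : 'Z[[t,q]] := tvar ^+ tweight s j * qvar ^+ qweight r s j.
have tweight_gt0 (j : 'I_n.+1) : (0 < tweight s j)%N by rewrite /tweight; case: ifP.
have Uu (j : 'I_n.+1) : 1 - u j \is a GRing.unit by apply: tvar_factor_unit.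
have Ut : 1 - tvar \is a GRing.unit.
  by have := tvar_factor_unit 1 (ltn0Sn 0); rewrite expr1 mulr1.
have -> : (1 - tvar) * (\prod_(1 <= j < n.+1) (1 - tvar ^+ s * qvar ^+ (j * r)))
    * (1 - tvar * qvar ^+ (n.+1 * r %/ s)) = (1 - tvar) * \prod_j (1 - u j).
  rewrite -mulrA; congr (_ * _).
  rewrite big_add1 big_mkord big_ord_recr /u /tweight /qweight /= ltnn.
  rewrite expr1 muln_divA //; congr (_ * _).
  by apply: eq_bigr => j _; rewrite ltn_ord.
rewrite invrM ?unitr_prod // -prodrV // [in RHS](mulrC (\prod_j _)).
apply/fpsP => K.
(* For the coefficient of [t^K], every geometric series may be cut at exponent [K], as each [u j]
   has positive degree in [t]. *)
have geom : eq_upto K ((1 - tvar)^-1 * \prod_j (1 - u j)^-1)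
    ((\sum_(l < K.+1) tvar ^+ l) * \prod_j \sum_(v < K.+1) u j ^+ v).
  apply: eq_uptoM.
    by have := geometric_upto (K := K) (F := 1 : 'Z[[t,q]]) (ltn0Sn 0); rewrite /= expr1 mulr1; apply.
  elim/big_rec2: _ => // j F G _ IH; apply: eq_uptoM IH.
  exact: (geometric_upto (tweight_gt0 j) (Uu j)).
rewrite (@eq_uptoM _ K _ _ _ _ (fun _ _ => erefl) geom) //.
transitivity (\sum_(f : {ffun 'I_n.+1 -> 'I_(r %/ s * K).+1} | (p %| \sum_k f k)%N)
                fps_X int ^+ (\sum_k f k)%N).
  apply/fpsP => i; rewrite fcoef_sum /= addn1 qint_exp fcoef_sum.
  case: ifP => [p_dvd_i|/negbT p_ndvd_i].
    rewrite [RHS]big_mkcond; apply: eq_bigr => f _; rewrite fcoefXn.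
    by case: eqP => [<-|_]; rewrite ?p_dvd_i ?if_same.
  rewrite big1 // => f p_dvd_f; rewrite fcoefXn.
  by case: eqP => // eq_i; rewrite eq_i p_dvd_f in p_ndvd_i.
rewrite (sum_words r_gt0 s_gt0 p_dvd_r s_dvd_r ps_dvd_rn).
(* Expanding the product of the truncated series produces the sum over exponent vectors [v] of
   [sum_words]. *)
rewrite bigA_distr_bigA mulr_suml fcoef_sum; apply: eq_bigr => g _.
rewrite mulrCA mulr_sumr mulr_sumr fcoef_sum big_mkcond.
apply: eq_bigr => v _.
rewrite mulr_suml -(fcoef_sum_tvar _ (fmaj g + _)); congr (fcoef _ K).
apply: eq_bigr => l _; congr (_ * _).
under [in RHS]eq_bigr do rewrite /u exprMn -!exprM.
by rewrite big_split /= !prodrXr mulrACA -!exprD.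
Qed.
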